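(* Let $(F_1,\|\cdot\|_1)$ be a normed space of integrable univariate functions over a Borel set $D_1\subseteq\mathbb{R}$ and, for $d\in\mathbb{N}$, let $(F_d,\|\cdot\|_d)$ be the $d$-fold tensor product space equipped with a crossnorm $\|\cdot\|_d$. Assume that in $F_1$ there exists a worst-case function $h_1$ (with $h_d(x_1,\dots,x_d)=\prod_{j=1}^dh_1(x_j)$ a worst-case function in $F_d$ for every $d$) which can be decomposed as $h_1=h_{1,1}+h_{1,2,(0)}+h_{1,2,(1)}$ such that: (DP1) $h_{1,1},h_{1,2,(0)},h_{1,2,(1)}\in F_1$; (DP2) there is $a\in\mathbb{R}$ such that $D_{(0)}=\{x\in D_1: x\le a\}$ and $D_{(1)}=\{x\in D_1: x\ge a\}$ are non-empty, the support of $h_{1,2,(0)}$ is contained in $D_{(0)}$, and the support of $h_{1,2,(1)}$ is contained in $D_{(1)}$; (DP3) the integrals $I_1(h_{1,2,(0)})$ and $I_1(h_{1,2,(1)})$ are positive; (DP4) for every $d\in\mathbb{N}$ and every choice, for each $\mathfrak{u}\subseteq[d]$, of a family $\mathcal{D}_{\mathfrak{u}}$ of subsets of $\mathfrak{u}$, $$\Big\|\sum_{\mathfrak{u}\subseteq[d]}\prod_{j\notin\mathfrak{u}}h_{1,1}(x_j)\sum_{\mathfrak{v}\in\mathcal{D}_{\mathfrak{u}}}\prod_{j\in\mathfrak{v}}h_{1,2,(0)}(x_j)\prod_{j\in\mathfrak{u}\setminus\mathfrak{v}}h_{1,2,(1)}(x_j)\Big\|_d\le\Big\|\sum_{\mathfrak{u}\subseteq[d]}\prod_{j\notin\mathfrak{u}}h_{1,1}(x_j)\sum_{\mathfrak{v}\subseteq\mathfrak{u}}\prod_{j\in\mathfrak{v}}h_{1,2,(0)}(x_j)\prod_{j\in\mathfrak{u}\setminus\mathfrak{v}}h_{1,2,(1)}(x_j)\Big\|_d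 .$$ Put $$\alpha:=\frac{\max(I_1(h_{1,2,(0)}),I_1(h_{1,2,(1)}))}{I_1(h_{1,2,(0)})+I_1(h_{1,2,(1)})}\in\left[\tfrac12,1\right),\quad \alpha_1:=I_1(h_{1,1}),\quad \alpha_2:=I_1(h_{1,2,(0)})+I_1(h_{1,2,(1)}),\quad \alpha_3:=\frac{\alpha_2}{\alpha_1}>0$$ (so $\alpha_1>0$ is understood). Then the $N$-th minimal integration error in $F_d$ satisfies $$e(N,d)\ge\frac{\alpha_1^d}{\|h_d\|_d}\sum_{k=0}^d\binom dk\alpha_3^k\left(1-N\alpha^k\right)_+ .$$ Furthermore, $$\liminf_{d\to\infty}\frac{e(\lfloor C^d\rfloor,d)}{e(0,d)}=1\quad\text{for all }C\in\left(1,\alpha^{-\alpha_3/(1+\alpha_3)}\right),$$ and, for such $C$, for all $\varepsilon\in(0,1)$ there exists $d_0(\varepsilon)\in\mathbb{N}$ such that $$N(\varepsilon,d)\ge\lfloor C^d\rfloor\quad\text{for all }d\ge d_0(\varepsilon).$$ In particular, the integration problem over $F_d$ suffers from the curse of dimensionality.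
   Context: Notation: $\mathbb{N}=\{1,2,\dots\}$, $[d]=\{1,\dots,d\}$, $(x)_+=\max(x,0)$; empty products are $1$. Setting: $D_d=D_1\times\dots\times D_1$ ($d$-fold). $F_d=F_1\otimes\dots\otimes F_1$ ($d$-fold) is a tensor product space of functions on $D_d$, with a norm $\|\cdot\|_d$ that is a crossnorm, i.e. $\|f\|_d=\|f_1\|_1\cdots\|f_d\|_1$ for elementary tensors $f(x_1,\dots,x_d)=f_1(x_1)\cdots f_d(x_d)$. $F_d$ is not claimed to be uniquely determined by these requirements. Integration: $I_d(f)=\int_{D_d}f(\boldsymbol{x})\,\mathrm{d}\boldsymbol{x}$. Initial error: $e(0,d)=\sup\{|I_d(f)|: f\in F_d,\ \|f\|_d\le1\}$. A linear algorithm is $A_{d,N}(f)=\sum_{k=1}^N a_kf(\boldsymbol{x}_k)$ with nodes $\boldsymbol{x}_k\in D_d$ and weights $a_k\in\mathbb{R}$; its worst-case error is $e(F_d,A_{d,N})=\sup\{|I_d(f)-A_{d,N}(f)|: f\in F_d,\ \|f\|_d\le1\}$. The $N$-th minimal error $e(N,d)$ is the minimum of $e(F_d,A_{d,N})$ over all linear algorithms using $N$ nodes. Information complexity: $N(\varepsilon,d)=\min\{N\in\mathbb{N}: e(N,d)\le\varepsilon\,e(0,d)\}$. Curse of dimensionality: for some fixed $\varepsilon>0$, $N(\varepsilon,d)$ grows at least exponentially fast in $d$. Worst-case function: $h_1\in F_1$ with $e(0,1)=I_1(h_1/\|h_1\|_1)$. Standing assumption: for every $d$ the tensor product $h_d(\boldsymbol{x})=\prod_{j=1}^dh_1(x_j)$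 is a worst-case function in $F_d$, i.e. $e(0,d)=I_d(h_d/\|h_d\|_d)$, hence $e(0,d)=e(0,1)^d$.
   Formalization: The formal theorem adds to (DP2) that, if a lies in D_1, at least one of h_{1,2,(0)}(a), h_{1,2,(1)}(a) is zero; without this the claim fails, e.g. when both are nonzero at a and point evaluation at (a,...,a) equals the integral on F_d, so e(1,d)=0. *)

(* Defs.v *)
From HB Require Import structures.
From mathcomp Require Import all_boot all_order all_algebra.
From mathcomp Require Import all_classical all_reals all_analysis.

Set Implicit Arguments.
Unset Strict Implicit.
Unset Printing Implicit Defensive.
Import Order.TTheory GRing.Theory Num.Theory.
Import numFieldNormedType.Exports.
Local Open Scope classical_set_scope.
Local Open Scope ring_scope.

Notation borelR R := (measurableTypeR R).

Section lebesgue_tuple.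
Context {R : realType}.
Local Notation RB := (borelR R).

Definition tuple_of_prod (d : nat) (p : RB * d.-tuple RB) : d.+1.-tuple RB :=
  [the d.+1.-tuple RB of p.1 :: p.2].

Definition prod_of_tuple (d : nat) (t : d.+1.-tuple RB) : RB * d.-tuple RB :=
  (thead t, [tuple of behead t]).

Lemma tuple_of_prodK (d : nat) : cancel (@tuple_of_prod d) (@prod_of_tuple d).
Proof.
by case=> x t; rewrite /prod_of_tuple theadE; congr pair; apply: val_inj.
Qed.

Lemma measurable_tuple_of_prod (d : nat) :
  measurable_fun setT (@tuple_of_prod d).
Proof. exact: measurable_cons. Qed.

Lemma measurable_prod_of_tuple (d : nat) :
  measurable_fun setT (@prod_of_tuple d).
Proof.
apply/measurable_fun_pairP; split; first exact: measurable_tnth.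
exact: measurable_behead.
Qed.

Section step.
Variables (d : nat) (mu : {sigma_finite_measure set (d.-tuple RB) -> \bar R}).

Definition lebesgue_step : set (d.+1.-tuple RB) -> \bar R :=
  pushforward (@lebesgue_measure R \x mu)%E (@tuple_of_prod d).

Let step0 : lebesgue_step set0 = 0%E.
Proof. by rewrite /lebesgue_step /pushforward preimage_set0 measure0. Qed.

Let step_ge0 A : (0 <= lebesgue_step A)%E.
Proof. by rewrite /lebesgue_step /pushforward measure_ge0. Qed.

Let step_sigma_additive : semi_sigma_additive lebesgue_step.
Proof.
have mf := @measurable_tuple_of_prod d.
move=> F mF tF mUF; rewrite /lebesgue_step /pushforward preimage_bigcup.
apply: measure_semi_sigma_additive.
- by move=> n; rewrite -[X in measurable X]setTI; exact: mf.
- apply/trivIsetP => /= i j _ _ ij; rewrite -preimage_setI.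
  by move/trivIsetP : tF => /(_ _ _ _ _ ij) ->//; rewrite preimage_set0.
- by rewrite -preimage_bigcup -[X in measurable X]setTI; exact: mf.
Qed.

HB.instance Definition _ := isMeasure.Build _ _ _
  lebesgue_step step0 step_ge0 step_sigma_additive.

Let step_sigma_finite : sigma_finite setT lebesgue_step.
Proof.
have /sigma_finiteP[F [TF ndF Foo]] := sigma_finiteT (@lebesgue_measure R).
have /sigma_finiteP[G [TG ndG Goo]] := sigma_finiteT mu.
exists (fun n => @prod_of_tuple d @^-1` (F n `*` G n)).
  apply/esym; rewrite -subTset => t _.
  have [k _ Fk] : (\bigcup_n F n) (prod_of_tuple t).1 by rewrite -TF.
  have [l _ Gl] : (\bigcup_n G n) (prod_of_tuple t).2 by rewrite -TG.
  exists (maxn k l) => //; split.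
  - by move: Fk; exact/subsetPset/ndF/leq_maxl.
  - by move: Gl; exact/subsetPset/ndG/leq_maxr.
move=> n; have [mF muF] := Foo n; have [mG muG] := Goo n; split.
  rewrite -[X in measurable X]setTI; apply: measurable_prod_of_tuple => //.
  exact: measurableX.
rewrite /lebesgue_step /pushforward -comp_preimage.
rewrite (_ : _ \o _ = id); last by apply/funext => p /=; rewrite tuple_of_prodK.
rewrite preimage_id product_measure1E// lte_mul_pinfty// ge0_fin_numE//.
Qed.

HB.instance Definition _ := Measure_isSigmaFinite.Build _ _ _
  lebesgue_step step_sigma_finite.

End step.

(* d-dimensional Lebesgue measure on the Borel sets of R^d: the d-fold product
   measure, transported along R * R^d ~ R^(d+1). *)
Fixpoint lebesgue_tuple (d : nat) :
    {sigma_finite_measure set (d.-tuple RB) -> \bar R} :=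
  match d with
  | 0 => [the {sigma_finite_measure set (0.-tuple RB) -> \bar R}
            of dirac [tuple]]
  | d'.+1 => [the {sigma_finite_measure set (d'.+1.-tuple RB) -> \bar R}
            of lebesgue_step (lebesgue_tuple d')]
  end.

End lebesgue_tuple.

(* A normed space of integrable functions on D.  Elements are abstract, with an
   evaluation map; two elements with the same values on D are equal, and values
   outside D are irrelevant. *)
Record funSpace (R : realType) (disp : measure_display)
    (T : measurableType disp) (mu : {measure set T -> \bar R}) (D : set T) :=
  FunSpace {
    fs_space :> normedModType R ;
    ev : fs_space -> T -> R ;
    ev_linear : forall (c : R) (f g : fs_space) (x : T), D x ->
      ev (c *: f + g) x = c * ev f x + ev g x ;
    ev_inj : forall f g : fs_space, (forall x, D x -> ev f x = ev g x) -> f = g ;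
    ev_integrable : forall f : fs_space, mu.-integrable D (EFin \o ev f)
  }.

Arguments ev {R disp T mu D f} : rename.

Section integration_problem.
Context (R : realType) (disp : measure_display) (T : measurableType disp).
Context (mu : {measure set T -> \bar R}) (D : set T) (F : funSpace mu D).

Definition Int (f : F) : R := \int[mu]_(x in D) ev f x.

Definition initial_error : \bar R :=
  ereal_sup [set `|Int f|%:E | f in [set f : F | `|f| <= 1]].

Definition worst_case_error (N : nat) (x : 'I_N -> T) (w : 'I_N -> R) : \bar R :=
  ereal_sup [set `|Int f - \sum_(k < N) w k * ev f (x k)|%:E
            | f in [set f : F | `|f| <= 1]].

Definition minimal_error (N : nat) : \bar R :=
  ereal_inf [set e | exists (x : 'I_N -> T) (w : 'I_N -> R),
    (forall k, D (x k)) /\ e = worst_case_error x w].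

(* Equal to +oo when no N is good enough. *)
Definition info_complexity (eps : R) : \bar R :=
  ereal_inf [set N%:R%:E | N in [set N : nat |
    (0 < N)%N /\ (minimal_error N <= eps%:E * initial_error)%E]].

Definition worst_case_function (h : F) : Prop :=
  initial_error = (Int (`|h|^-1 *: h))%:E.

End integration_problem.

(* The support relative to D1. *)
Definition supp (R : realType) (D1 : set (borelR R))
    (F1 : funSpace (@lebesgue_measure R) D1) (f : F1) : set R :=
  D1 `&` closure ([set x | D1 x /\ ev f x != 0] : set R).

Definition cube (R : realType) (D1 : set (borelR R)) (d : nat) :
    set (d.-tuple (borelR R)) :=
  [set x | forall j, D1 (tnth x j)].

Arguments cube {R} D1 d.

(* A d-fold tensor product space of F1 with a crossnorm.  The algebraic tensor
   product is only required to be dense, so that both it and (partial)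
   completions of it are allowed; the 1-fold tensor product is F1 itself. *)
Record tensorPower (R : realType) (D1 : set (borelR R))
    (F1 : funSpace (@lebesgue_measure R) D1) (d : nat) := TensorPower {
  tp_space :> funSpace (@lebesgue_tuple R d) (cube D1 d) ;
  tensor : ('I_d -> F1) -> tp_space ;
  tensorE : forall (f : 'I_d -> F1) x, cube D1 d x ->
    ev (tensor f) x = \prod_(j < d) ev (f j) (tnth x j) ;
  crossnorm : forall f : 'I_d -> F1, `|tensor f| = \prod_(j < d) `|f j| ;
  tensor_dense : dense [set g : tp_space | exists s : seq (R * ('I_d -> F1)),
    g = \sum_(p <- s) p.1 *: tensor p.2] ;
  tensor_one : d = 1%N -> forall g : tp_space, exists f, g = tensor f
}.

Arguments tensor {R D1 F1 d t} : rename.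

Definition tensor_pow (R : realType) (D1 : set (borelR R))
    (F1 : funSpace (@lebesgue_measure R) D1) (d : nat) (F : tensorPower F1 d)
    (h : F1) : F :=
  tensor (fun _ => h).

(* The function
   prod_(j notin u) h11 x_j * prod_(j in v) h120 x_j * prod_(j in u \ v) h121 x_j,
   for v a subset of u. *)
Definition block (R : realType) (D1 : set (borelR R))
    (F1 : funSpace (@lebesgue_measure R) D1) (d : nat) (F : tensorPower F1 d)
    (h11 h120 h121 : F1) (u v : {set 'I_d}) : F :=
  tensor (fun j => if j \notin u then h11 else if j \in v then h120 else h121).

Definition curse_of_dimensionality (R : realType) (n : R -> nat -> \bar R) :=
  exists eps c gamma : R, exists d0 : nat,
    [/\ 0 < eps, 0 < c, 0 < gamma &
      forall d, (d0 <= d)%N -> ((c * (1 + gamma) ^+ d)%:E <= n eps d)%E].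

(* Main.v *)
(* Given nodes x_1, ..., x_N, every coordinate of x_k kills h120 or h121, so for
   each u at most one block (u, v) is non-zero at x_k.  Deleting these at most N
   blocks for each u from the expansion of h_d gives a function vanishing at all
   nodes whose norm is at most that of h_d by (DP4), and whose integral is at
   least the sum over u of
   alpha1^(d-|u|) * (alpha2^|u| - N * (alpha * alpha2)^|u|)_+.
   For the asymptotics, (1 - t)_+ >= 1 - t^s for 0 < s <= 1 turns the binomial
   sum into (1 + alpha3)^d - N^s (1 + alpha3 alpha^s)^d, and for small s the
   subtracted term with N <= C^d is exponentially smaller than the first. *)

Require Import Defs.
From HB Require Import structures.
From mathcomp Require Import all_boot all_order all_algebra.
From mathcomp Require Import all_classical all_reals all_analysis.
From mathcomp Require Import measurable_realfun ring lra.

Set Implicit Arguments.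
Unset Strict Implicit.
Unset Printing Implicit Defensive.
Import Order.TTheory GRing.Theory Num.Theory.
Import numFieldNormedType.Exports.
Local Open Scope classical_set_scope.
Local Open Scope ring_scope.

(** * Expanding products over subsets of the coordinates *)

Section product_expansion.
Variables (R : comPzRingType) (I : finType).
Implicit Types (A B C : I -> R) (u v : {set I}).

(** Extending [B] by zero off [u] allows the distributive law over all subsets [v] of [I]; each [v]
    not inside [u] then picks up a zero factor. *)
Lemma sum_powerset_prod A B C u :
  \sum_(v in powerset u)
     \prod_j (if j \notin u then A j else if j \in v then B j else C j) =
  \prod_j (if j \notin u then A j else B j + C j).
Proof.
pose G j := if j \notin u then A j else C j.
pose F j := if j \in u then B j else 0.
transitivity (\prod_j (F j + G j)); last first.
  by apply: eq_bigr => j _; rewrite /F /G; case: (j \in u); rewrite //= add0r.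
rewrite bigA_distr [RHS](bigID (mem (powerset u))) /= [X in _ + X]big1 ?addr0.
  apply: eq_bigr => v; rewrite powersetE => /fintype.subsetP vu.
  apply: eq_bigr => j _; rewrite /F /G; case: (boolP (j \in v)) => [jv|jv].
    by rewrite vu.
  by case: (j \in u).
move=> v; rewrite powersetE => /fintype.subsetPn[j jv ju].
by rewrite (bigD1 j) //= jv /F (negbTE ju) mul0r.
Qed.

Lemma sum_set_prod A B :
  \sum_(u : {set I}) \prod_j (if j \notin u then A j else B j) =
  \prod_j (A j + B j).
Proof.
rewrite (eq_bigr (fun j => B j + A j)) => [|j _]; last exact: addrC.
rewrite bigA_distr; apply: eq_bigr => u _; apply: eq_bigr => j _.
by case: (j \in u).
Qed.

Lemma prod_const_set (a b : R) u :
  \prod_j (if j \notin u then a else b) = a ^+ (#|I| - #|u|) * b ^+ #|u|.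
Proof.
rewrite (bigID (mem u)) /= mulrC; congr (_ * _).
  rewrite (eq_bigr (fun=> a)) => [|j ->//].
  rewrite prodr_const; congr (_ ^+ _).
  by rewrite -(cardC (mem u)) addKn; apply: eq_card => j; rewrite !inE.
rewrite (eq_bigr (fun=> b)) ?prodr_const // => j ->//.
Qed.

Lemma sum_set_card (G : nat -> R) :
  \sum_(u : {set I}) G #|u| = \sum_(k < #|I|.+1) 'C(#|I|, k)%:R * G k.
Proof.
rewrite (partition_big (fun u : {set I} => inord #|u| : 'I_#|I|.+1) xpredT) //=.
apply: eq_bigr => k _.
rewrite (eq_bigl (fun u : {set I} => u \in [set u : {set I} | #|u| == k]%SET)).
  rewrite (eq_bigr (fun=> G k)) => [|u]; last by rewrite inE => /eqP ->.
  by rewrite sumr_const card_draws mulr_natl.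
move=> u; rewrite inE -val_eqE /= inordK // ltnS; exact: max_card.
Qed.

End product_expansion.

(** * Fubini for a product of two functions of separate variables *)

Section product_integral.
Context d1 d2 (T1 : measurableType d1) (T2 : measurableType d2) (R : realType).
Variable m1 : {sigma_finite_measure set T1 -> \bar R}.
Variable m2 : {sigma_finite_measure set T2 -> \bar R}.
Variables (f : T1 -> R) (g : T2 -> R).
Hypothesis intf : m1.-integrable setT (EFin \o f).
Hypothesis intg : m2.-integrable setT (EFin \o g).
Let fg (p : T1 * T2) := f p.1 * g p.2.

Lemma integrable_prodM : (m1 \x m2)%E.-integrable setT (EFin \o fg).
Proof.
have mf : measurable_fun setT f by apply/measurable_EFinP/measurable_int/intf.
have mg : measurable_fun setT g by apply/measurable_EFinP/measurable_int/intg.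
apply/integrable12ltyP.
  apply/measurable_EFinP; apply: measurable_funM.
    exact: (measurableT_comp mf measurable_fst).
  exact: (measurableT_comp mg measurable_snd).
under eq_integral => x _.
  under eq_integral => y _ do rewrite /= /fg /= normrM EFinM.
  rewrite ge0_integralZl//; last first.
    by apply/measurable_EFinP; exact: measurableT_comp.
  over.
have /integrableP[_ foo] := intf; have /integrableP[_ goo] := intg.
rewrite ge0_integralZr//; last 2 first.
- by apply/measurable_EFinP; exact: measurableT_comp.
- exact: integral_ge0.
by rewrite lte_mul_pinfty// ?ge0_fin_numE//; exact: integral_ge0.
Qed.

Lemma Rintegral_prodM :
  \int[(m1 \x m2)%E]_z fg z = (\int[m1]_x f x) * (\int[m2]_y g y).
Proof.
rewrite /Rintegral -integral12_prod_meas1; last exact: integrable_prodM.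
have foo := integrable_fin_num measurableT intf.
have goo := integrable_fin_num measurableT intg.
rewrite -fineM// -(fineK goo) -integralZr//; congr fine.
apply: eq_integral => x _; rewrite /fubini_F /fg fineK //= -integralZl//.
Qed.

End product_integral.

(** * Integrals of product functions over R^d *)

Section tuple_integral.
Variable R : realType.

Lemma prod_of_tupleK d : cancel (@prod_of_tuple R d) (@tuple_of_prod R d).
Proof. by move=> t; apply: val_inj; rewrite /= [in RHS](tuple_eta t). Qed.

Local Notation lebesgue := (@lebesgue_measure R).
Local Notation cube_prod g :=
  (fun t : _.-tuple (borelR R) => \prod_j g j (tnth t j)).

(** Induction on [d], transporting along [tuple_of_prod]. Integrability and value are proved
    together, since Fubini in the induction step uses the integrability of the remaining [d]
    factors. *)
Lemma tuple_product_integral d (g : 'I_d -> borelR R -> R) :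
  (forall j, lebesgue.-integrable setT (EFin \o g j)) ->
  (lebesgue_tuple d).-integrable setT (EFin \o cube_prod g) /\
  \int[lebesgue_tuple d]_t cube_prod g t = \prod_j \int[lebesgue]_x g j x.
Proof.
elim: d g => [|d IH] g intg.
  have gE : cube_prod g = cst 1 by apply/funext => t; rewrite big_ord0.
  rewrite gE big_ord0; split.
    exact: (@finite_measure_integrable_cst _ _ _ (dirac [tuple])).
  rewrite [LHS](Rintegral_cst _ measurableT) mul1r.
  exact: (congr1 fine (@diracT _ (0.-tuple (borelR R)) R [tuple])).
pose g' (j : 'I_d) := g (lift ord0 j).
have [intg' valg'] := IH g' (fun j => intg _).
pose fg (p : borelR R * d.-tuple (borelR R)) :=
  g ord0 p.1 * \prod_j g' j (tnth p.2 j).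
have gE : cube_prod g \o @tuple_of_prod R d = fg.
  apply/funext => p /=; rewrite big_ord_recl /fg tnth0; congr (_ * _).
  by apply: eq_bigr => j _; rewrite tnthS.
have intfg := integrable_prodM (intg ord0) intg'.
have mg : measurable_fun setT (EFin \o cube_prod g).
  apply/measurable_EFinP.
  have -> : cube_prod g = fg \o @prod_of_tuple R d.
    by apply/funext => t; rewrite -gE /= prod_of_tupleK.
  apply: measurableT_comp (@measurable_prod_of_tuple R d).
  exact/measurable_EFinP/measurable_int/intfg.
have mtp := @measurable_tuple_of_prod R d.
split.
  apply: integrable_pushforward => //.
  by rewrite preimage_setT -compA gE.
rewrite /Rintegral /= integral_pushforward//; last first.
  by rewrite preimage_setT -compA gE.
rewrite preimage_setT big_ord_recl -valg' -[RHS]Rintegral_prodM//.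
by rewrite -compA gE.
Qed.

End tuple_integral.

(** * Linearity of evaluation and integration; general error bounds *)

Section funSpace_theory.
Context (R : realType) (disp : measure_display) (T : measurableType disp).
Context (mu : {measure set T -> \bar R}) (D : set T) (F : funSpace mu D).
Implicit Types f g : F.

Lemma evD f g x : D x -> ev (f + g) x = ev f x + ev g x.
Proof. by move=> Dx; rewrite -[f in LHS]scale1r ev_linear// mul1r. Qed.

Lemma ev0 x : D x -> ev (0 : F) x = 0.
Proof. by move=> Dx; apply: (addrI (ev (0 : F) x)); rewrite -evD// !addr0. Qed.

Lemma evZ c f x : D x -> ev (c *: f) x = c * ev f x.
Proof. by move=> Dx; rewrite -[_ *: _]addr0 ev_linear// ev0// addr0. Qed.

Lemma ev_sum (I : Type) (r : seq I) (P : pred I) (f : I -> F) x : D x ->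
  ev (\sum_(i <- r | P i) f i) x = \sum_(i <- r | P i) ev (f i) x.
Proof.
by move=> Dx; apply: (big_morph (fun g => ev g x)) => [g h|];
  [exact: evD|exact: ev0].
Qed.

Hypothesis mD : measurable D.

Lemma IntD f g : Int (f + g) = Int f + Int g.
Proof.
rewrite /Int -RintegralD//; try exact: ev_integrable.
by apply: eq_Rintegral => x; rewrite inE => /evD.
Qed.

Lemma IntZ c f : Int (c *: f) = c * Int f.
Proof.
rewrite /Int -RintegralZl//; last exact: ev_integrable.
by apply: eq_Rintegral => x; rewrite inE => /evZ.
Qed.

Lemma Int0 : Int (0 : F) = 0.
Proof. by rewrite -(scale0r (0 : F)) IntZ mul0r. Qed.

Lemma Int_sum (I : Type) (r : seq I) (P : pred I) (f : I -> F) :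
  Int (\sum_(i <- r | P i) f i) = \sum_(i <- r | P i) Int (f i).
Proof. exact: (big_morph _ IntD Int0). Qed.

(** The function [c^-1 *: f] lies in the unit ball and the algorithm sees only zeros of it, so its
    whole integral is error. *)
Lemma worst_case_error_ge N (x : 'I_N -> T) (w : 'I_N -> R) f c :
  (forall k, D (x k)) -> (forall k, ev f (x k) = 0) -> 0 < c -> `|f| <= c ->
  ((Int f / c)%:E <= worst_case_error F x w)%E.
Proof.
move=> Dx fx0 c0 fc; apply: le_ereal_sup_tmp.
exists `|Int (c^-1 *: f) - \sum_(k < N) w k * ev (c^-1 *: f) (x k)|%:E.
  exists (c^-1 *: f) => //=.
  have c'0 : 0 <= c^-1 by rewrite invr_ge0 ltW.
  by rewrite normrZ (ger0_norm c'0) mulrC ler_pdivrMr// mul1r.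
rewrite big1 ?subr0 => [|k _]; last by rewrite evZ// fx0 !mulr0.
by rewrite IntZ lee_fin mulrC ler_norm.
Qed.

(** With all weights zero the error is the initial one; a point of [D] serves as every node. *)
Lemma minimal_error_le_initial N : D !=set0 ->
  (minimal_error F N <= initial_error F)%E.
Proof.
move=> [x Dx]; apply: ge_ereal_inf.
exists (@worst_case_error _ _ _ _ _ F N (fun=> x) (fun=> 0)).
  by exists (fun=> x), (fun=> 0).
apply: ge_ereal_sup => _ [f f1 <-]; apply: le_ereal_sup_tmp.
exists `|Int f|%:E; first by exists f.
by rewrite big1 ?subr0// => k _; rewrite mul0r.
Qed.

End funSpace_theory.

(** * Integrals of elementary tensors and the block decomposition *)

Section tensor_theory.
Context (R : realType) (D1 : set (borelR R)).
Context (F1 : funSpace (@lebesgue_measure R) D1).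
Hypothesis mD1 : measurable D1.

Lemma measurable_cube d : measurable (cube D1 d).
Proof.
have -> : cube D1 d = \bigcap_(j in [set: 'I_d]) (fun t => tnth t j) @^-1` D1.
  by apply/seteqP; split => [t tD j _|t tD j]; exact: tD.
apply: fin_bigcap_measurable => // j _.
rewrite -[X in measurable X]setTI; exact: measurable_tnth.
Qed.

(** Extending each factor by zero outside [D1] replaces the cube by all of R^d, where the product
    formula applies; a point outside the cube has a coordinate that kills the product. *)
Lemma Int_tensor d (F : tensorPower F1 d) (f : 'I_d -> F1) :
  Int (tensor f : F) = \prod_j Int (f j).
Proof.
pose g j := ev (f j) \_ D1.
have intg j : (@lebesgue_measure R).-integrable setT (EFin \o g j).
  by rewrite -restrict_EFin -integrable_mkcond//; exact: ev_integrable.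
have [_ gE] := tuple_product_integral intg.
rewrite /Int Rintegral_mkcond.
under [RHS]eq_bigr do rewrite Rintegral_mkcond.
rewrite -gE; congr Rintegral; apply/funext => t; rewrite patchE.
case: ifPn => [|/negP]; rewrite inE => tD.
  by rewrite tensorE//; apply: eq_bigr => j _; rewrite /g patchE mem_set.
have /existsNP[j tj] := tD.
by rewrite (bigD1 j)//= /g patchE memNset ?mul0r.
Qed.

(** By [ev_inj] a pointwise identity suffices: [u] records the coordinates where [f] is not chosen,
    and [v] those in [u] where [g] is chosen. *)
Lemma tensor_pow_decomposition d (F : tensorPower F1 d) (f g h : F1) :
  tensor_pow F (f + g + h) =
  \sum_(u : {set 'I_d}) \sum_(v in powerset u) block F f g h u v.
Proof.
apply: ev_inj => t tD; rewrite ev_sum// tensorE//.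
under [RHS]eq_bigr => u _.
  rewrite ev_sum//.
  under eq_bigr => v _.
    rewrite tensorE//.
    under eq_bigr => j _ do
      rewrite (fun_if (fun k : F1 => ev k _)) (fun_if (fun k : F1 => ev k _)).
    over.
  rewrite (sum_powerset_prod (fun j => ev f (tnth t j))).
  over.
rewrite sum_set_prod; apply: eq_bigr => j _.
by rewrite !evD// addrA.
Qed.

Lemma Int_block d (F : tensorPower F1 d) (f g h : F1) u v :
  Int (block F f g h u v) =
  \prod_j (if j \notin u then Int f else if j \in v then Int g else Int h).
Proof.
rewrite Int_tensor; apply: eq_bigr => j _.
by case: ifP => // _; case: ifP.
Qed.

Lemma supp_ev0 (f : F1) (A : set R) (x : R) :
  supp f `<=` A -> D1 x -> ~ A x -> ev f x = 0.
Proof.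
move=> fA D1x nAx; apply: contrapT => /eqP fx; apply: nAx; apply: fA.
by split=> //; exact: subset_closure.
Qed.

End tensor_theory.

(** * Blocks vanishing at all nodes, and their total integral *)

Section fooling_function.
Context (R : realType) (D1 : set (borelR R)).
Context (F1 : funSpace (@lebesgue_measure R) D1).
Variables (d : nat) (F : tensorPower F1 d) (f g h : F1).
Hypothesis mD1 : measurable D1.
Hypothesis gh0 : forall x, D1 x -> ev g x = 0 \/ ev h x = 0.
Hypotheses (If : 0 < Int f) (Ig : 0 < Int g) (Ih : 0 < Int h).
Variables (N : nat) (x : 'I_N -> d.-tuple (borelR R)).
Hypothesis xD : forall k, cube D1 d (x k).
Let M := Num.max (Int g) (Int h).

(* The blocks [block F f g h u v] that may be non-zero at the node [x k] are
   those with [v = u :&: node_type k]. *)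
Definition node_type k : {set 'I_d} := [set j | ev h (tnth (x k) j) == 0]%SET.

Definition fooling_family (u : {set 'I_d}) : {set {set 'I_d}} :=
  powerset u :\: [set u :&: node_type k | k : 'I_N]%SET.

(** A non-zero value would force, for [j] in [u], that [h] vanishes at coordinate [j] exactly when
    [j] is in [v]; then [v] would be [u :&: node_type k], which is excluded. *)
Lemma block_eq0 (u v : {set 'I_d}) k : v \in fooling_family u ->
  ev (block F f g h u v) (x k) = 0.
Proof.
rewrite finset.in_setD powersetE => /andP[/imsetP vx vu]; rewrite tensorE//.
apply/eqP; apply: contraT => /prodf_neq0 nz; exfalso; apply: vx.
exists k => //; apply/setP => j; rewrite finset.in_setI [in RHS]inE.
have := nz j isT; have := gh0 (xD k j); have := fintype.subsetP vu j.
case: (j \in u) => /=; last by case: (j \in v) => // /(_ isT).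
case: (j \in v) => /= _; last by move=> _ /negbTE ->.
by case=> ->; rewrite eqxx.
Qed.

Lemma Int_block_bounds (u v : {set 'I_d}) :
  0 <= Int (block F f g h u v) <= Int f ^+ (d - #|u|) * M ^+ #|u|.
Proof.
have M0 : 0 <= M by rewrite le_max ltW.
rewrite Int_block//; apply/andP; split.
  by apply: prodr_ge0 => j _; case: ifP => _; [|case: ifP => _]; exact: ltW.
have := prod_const_set (Int f) M u; rewrite card_ord => <-.
apply: ler_prod => j _.
by case: ifP => _; [|case: ifP => _]; rewrite ltW//= le_max lexx ?orbT.
Qed.

(** All blocks over [u] together integrate to [Int f ^+ (d - #|u|) * (Int g + Int h) ^+ #|u|], and
    each of the at most [N] deleted ones accounts for at most [Int f ^+ (d - #|u|) * M ^+ #|u|]. *)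
Lemma Int_fooling_family (u : {set 'I_d}) :
  Int f ^+ (d - #|u|) *
    Num.max ((Int g + Int h) ^+ #|u| - N%:R * M ^+ #|u|) 0 <=
  \sum_(v in fooling_family u) Int (block F f g h u v).
Proof.
have If0 := exprn_ge0 (d - #|u|) (ltW If).
(* The bound by 0 holds because every block has a non-negative integral. *)
rewrite maxr_pMr// mulr0 ge_max; apply/andP; split; last first.
  by apply: sumr_ge0 => v _; have /andP[] := Int_block_bounds u v.
pose S : {set {set 'I_d}} := [set u :&: node_type k | k : 'I_N]%SET.
have /esym := sum_powerset_prod (fun=> Int f) (fun=> Int g) (fun=> Int h) u.
rewrite prod_const_set card_ord.
rewrite (eq_bigr (fun v => Int (block F f g h u v))) => [|v _]; last first.
  by rewrite (Int_block mD1).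
rewrite (big_setID S)/= -/(fooling_family u) mulrBr => ->.
rewrite lerBlDl lerD2r.
apply: (@le_trans _ _ (\sum_(v in powerset u :&: S)
                         Int f ^+ (d - #|u|) * M ^+ #|u|)).
  by apply: ler_sum => v _; have /andP[] := Int_block_bounds u v.
rewrite sumr_const -[leLHS]mulr_natl [leRHS]mulrCA ler_wpM2r//.
  by rewrite mulr_ge0// exprn_ge0// le_max ltW.
rewrite ler_nat; apply: (leq_trans (subset_leq_card (subsetIr _ _))).
by apply: (leq_trans (leq_imset_card _ _)); rewrite card_ord.
Qed.

End fooling_function.

(** * The lower bound for the minimal error *)

Section lower_bound.
Context (R : realType) (D1 : set (borelR R)).
Context (F1 : funSpace (@lebesgue_measure R) D1).
Variables (d : nat) (F : tensorPower F1 d) (f g h : F1).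
Hypothesis mD1 : measurable D1.
Hypothesis gh0 : forall x, D1 x -> ev g x = 0 \/ ev h x = 0.
Hypotheses (If : 0 < Int f) (Ig : 0 < Int g) (Ih : 0 < Int h).
Let alpha := Num.max (Int g) (Int h) / (Int g + Int h).
Let alpha3 := (Int g + Int h) / Int f.

Lemma minimal_error_ge N :
  0 < `|tensor_pow F (f + g + h)| ->
  (forall DD : {set 'I_d} -> {set {set 'I_d}},
    (forall u, DD u \subset powerset u) ->
    `|\sum_(u : {set 'I_d}) \sum_(v in DD u) block F f g h u v| <=
    `|\sum_(u : {set 'I_d}) \sum_(v in powerset u) block F f g h u v|) ->
  ((Int f ^+ d / `|tensor_pow F (f + g + h)| *
     \sum_(k < d.+1) 'C(d, k)%:R * alpha3 ^+ k *
       Num.max (1 - N%:R * alpha ^+ k) 0)%:E <= minimal_error F N)%E.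
Proof.
move=> hd0 DP4; apply: le_ereal_inf_tmp => _ [x [w [xD ->]]].
pose fool := \sum_(u : {set 'I_d}) \sum_(v in fooling_family h x u)
               block F f g h u v.
have fool_le : `|fool| <= `|tensor_pow F (f + g + h)|.
  rewrite tensor_pow_decomposition; apply: DP4 => u.
  exact: finset.subsetDl.
have fool0 k : ev fool (x k) = 0.
  rewrite ev_sum// big1// => u _; rewrite ev_sum// big1// => v.
  exact: block_eq0.
have mcube := @measurable_cube _ _ mD1 d.
apply: le_trans _ (worst_case_error_ge mcube w xD fool0 hd0 fool_le).
rewrite lee_fin mulrAC ler_pM2r ?invr_gt0//.
rewrite Int_sum//.
under [leRHS]eq_bigr do rewrite Int_sum//.
apply: le_trans _ (ler_sum _ (fun u _ => Int_fooling_family F mD1 If Ig Ih x u)).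
(* The bound depends on [u] only through its cardinality, which produces the binomial coefficients;
   what remains is a termwise identity. *)
rewrite (@sum_set_card _ 'I_d (fun k => Int f ^+ (d - k) *
  Num.max ((Int g + Int h) ^+ k -
           N%:R * Num.max (Int g) (Int h) ^+ k) 0)) card_ord mulr_sumr.
rewrite le_eqVlt; apply/orP; left; apply/eqP; apply: eq_bigr => k _.
have gh : 0 < Int g + Int h by rewrite addr_gt0.
have -> : Num.max
    ((Int g + Int h) ^+ k - N%:R * Num.max (Int g) (Int h) ^+ k) 0 =
    (Int g + Int h) ^+ k * Num.max (1 - N%:R * alpha ^+ k) 0.
  rewrite maxr_pMr ?exprn_ge0 ?ltW// mulr0 mulrBr mulr1 mulrCA -exprMn.
  by rewrite /alpha (mulrC _ (_ / _)) divfK// gt_eqF.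
have -> : Int f ^+ d = Int f ^+ (d - k) * Int f ^+ k.
  by rewrite -exprD subnK// -ltnS.
have -> : (Int g + Int h) ^+ k = alpha3 ^+ k * Int f ^+ k.
  by rewrite -exprMn /alpha3 divfK// gt_eqF.
ring.
Qed.

End lower_bound.

(** * Asymptotics of the binomial sum *)

Section binomial_bound.
Variable R : realType.
Implicit Types (alpha rho C s : R).

(** For [t <= 1] the power [s] does not decrease [t]; for [t >= 1] the left side is at most 0. *)
Lemma powR_subr_le_max s (t : R) : 0 < t -> 0 < s <= 1 ->
  1 - t `^ s <= Num.max (1 - t) 0.
Proof.
move=> t0 /andP[s0 s1]; have [t1|/ltW t1] := leP t 1.
  by rewrite le_max lerD2l lerN2 ger1_powR// t0.
by rewrite le_max subr_le0 -(powRr0 t) ler_powR ?orbT// ltW.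
Qed.

(** Termwise with [t = N * alpha ^ k]: as [t ^ s] is [N ^ s] times a [k]-th power, the subtracted
    terms again form a binomial expansion. *)
Lemma binomial_sum_ge alpha rho s d N : 0 < alpha -> 0 < rho -> 0 < s <= 1 ->
  (0 < N)%N ->
  (1 + rho) ^+ d - N%:R `^ s * (1 + rho * alpha `^ s) ^+ d <=
  \sum_(k < d.+1) 'C(d, k)%:R * rho ^+ k * Num.max (1 - N%:R * alpha ^+ k) 0.
Proof.
move=> a0 r0 s01 N0; rewrite !exprDn mulr_sumr -sumrB; apply: ler_sum => k _.
rewrite !expr1n !mul1r -[rho ^+ k *+ _]mulr_natl -[(_ ^+ k) *+ _]mulr_natl.
have -> : 'C(d, k)%:R * rho ^+ k -
    N%:R `^ s * ('C(d, k)%:R * (rho * alpha `^ s) ^+ k) =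
    'C(d, k)%:R * rho ^+ k * (1 - (N%:R * alpha ^+ k) `^ s).
  rewrite powRM// ?exprn_ge0 ?ltW// -[alpha ^+ k]powR_mulrn ?ltW//.
  rewrite -powRrM [k%:R * s]mulrC powRrM powR_mulrn ?powR_ge0// exprMn; ring.
apply: ler_wpM2l; first by rewrite mulr_ge0// exprn_ge0// ltW.
apply: powR_subr_le_max => //.
by rewrite mulr_gt0 ?exprn_gt0// ltr0n.
Qed.

(* The left-hand side, divided by the right-hand side, is 1 at [s = 0] with
   logarithmic derivative [ln C + rho / (1 + rho) * ln alpha < 0]. *)
Lemma exists_small_exponent alpha rho C : 0 < alpha -> 0 < rho ->
  1 < C < alpha `^ (- (rho / (1 + rho))) ->
  exists2 s, 0 < s <= 1 &
    C `^ s * (1 + rho * alpha `^ s) < 1 + rho.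
Proof.
move=> a0 r0 /andP[C1 Ca]; have C0 : 0 < C by exact: lt_trans C1.
set p := rho / (1 + rho) in Ca.
pose c := ln C; pose L := - ln alpha.
have c0 : 0 < c by exact: ln_gt0.
(* This is the logarithm of the upper bound on [C]; the gap [p * L - c] drives the rest. *)
have cL : c < p * L.
  by rewrite /L mulrN -mulNr -ln_powR ltr_ln ?posrE// powR_gt0.
have r10 : 0 < 1 + rho by lra.
have pE : p * (1 + rho) = rho by rewrite /p divfK// gt_eqF.
have p0 : 0 < p by rewrite divr_gt0.
have L0 : 0 < L by rewrite -(pmulr_rgt0 _ p0); exact: lt_trans cL.
(* The second entry keeps the quadratic error [s * (c * L)] within half of the gap. *)
pose s := Num.min 1 ((p * L - c) / (2 * (c * L))).
have s0 : 0 < s by rewrite lt_min ltr01 divr_gt0 ?mulr_gt0 ?subr_gt0.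
exists s; first by rewrite s0 ge_min lexx.
have scL : s * (c * L) < p * L - c.
  have cL0 : 0 < c * L by rewrite mulr_gt0.
  have : s * (2 * (c * L)) <= p * L - c.
    by rewrite -ler_pdivlMr ?mulr_gt0// ge_min lexx orbT.
  have := mulr_gt0 s0 cL0; lra.
have alphaE : alpha `^ s = (expR (s * L))^-1.
  by rewrite /powR gt_eqF// /L mulrN expRN invrK.
have CE : C `^ s = (expR (- (s * c)))^-1.
  by rewrite /powR gt_eqF// expRN invrK.
rewrite alphaE CE mulrC ltr_pdivrMr ?expR_gt0//.
have sL0 : 0 < s * L by rewrite mulr_gt0.
have sL10 : 0 < 1 + s * L by lra.
(* Both exponentials are replaced by the tangent bound [1 + x <= expR x], leaving a rational
   inequality in [s]. *)
have e1 : (expR (s * L))^-1 <= (1 + s * L)^-1.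
  by rewrite lef_pV2 ?posrE ?expR_gt0// expR_ge1Dx.
have e2 : 1 - s * c <= expR (- (s * c)) by exact: expR_ge1Dx.
apply: (@lt_le_trans _ _ ((1 + rho) * (1 - s * c))); last by rewrite ler_pM2l.
apply: (@le_lt_trans _ _ (1 + rho * (1 + s * L)^-1)).
  by rewrite lerD2l ler_pM2l.
rewrite -(ltr_pM2r sL10) mulrDl mul1r mulfVK ?gt_eqF//.
(* Once [1 + s * L] is cleared, right side minus left side equals this product, by
   [p * (1 + rho) = rho]. *)
have : 0 < s * (1 + rho) * (p * L - c - s * (c * L)).
  by rewrite !mulr_gt0// subr_gt0.
have -> : s * (1 + rho) * (p * L - c - s * (c * L)) =
   s * L * (p * (1 + rho)) - s * (1 + rho) * (c + s * (c * L)) by ring.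
by rewrite pE; nra.
Qed.

(** Here [r] is the quotient of the two sides in [exists_small_exponent]; [N <= C ^ d] bounds
    [N ^ s] by [(C ^ s) ^ d], so one [r] serves all [d] and [N]. *)
Lemma binomial_sum_asymptotics alpha rho C : 0 < alpha -> 0 < rho ->
  1 < C < alpha `^ (- (rho / (1 + rho))) ->
  exists2 r, 0 < r < 1 & forall d N, (0 < N)%N -> N%:R <= C ^+ d ->
    (1 + rho) ^+ d * (1 - r ^+ d) <=
    \sum_(k < d.+1) 'C(d, k)%:R * rho ^+ k * Num.max (1 - N%:R * alpha ^+ k) 0.
Proof.
move=> a0 r0 C1; have [s s01 sC] := exists_small_exponent a0 r0 C1.
have C0 : 0 < C by case/andP: C1 => C1 _; exact: lt_trans C1.
have r10 : 0 < 1 + rho by rewrite addr_gt0.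
have q0 : 0 < 1 + rho * alpha `^ s by rewrite addr_gt0// mulr_gt0// powR_gt0.
exists (C `^ s * (1 + rho * alpha `^ s) / (1 + rho)).
  by rewrite divr_gt0 ?mulr_gt0 ?powR_gt0//= ltr_pdivrMr// mul1r.
move=> d N N0 NC; apply: le_trans (binomial_sum_ge d a0 r0 s01 N0).
rewrite mulrBr mulr1 lerD2l lerN2 -exprMn [(1 + rho) * _]mulrC divfK ?gt_eqF// exprMn.
rewrite ler_pM2r ?exprn_gt0// -powR_mulrn ?powR_ge0// -powRrM mulrC powRrM.
rewrite powR_mulrn; last exact: ltW.
by apply: ge0_ler_powR; rewrite ?nnegrE ?exprn_ge0 ?(ltW C0)//; case/andP: s01 => /ltW.
Qed.

End binomial_bound.

Theorem theorem3 (R : realType) (D1 : set (borelR R)) (mD1 : measurable D1)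
    (F1 : funSpace (@lebesgue_measure R) D1)
    (F : forall d : nat, tensorPower F1 d)
    (h1 h11 h120 h121 : F1) (a : R)
    (worst_h1 : worst_case_function h1)
    (worst_hd : forall d, (0 < d)%N -> worst_case_function (tensor_pow (F d) h1))
    (h1E : h1 = h11 + h120 + h121)
    (D0_neq0 : [set x : R | D1 x /\ x <= a] !=set0)
    (D1_neq0 : [set x : R | D1 x /\ a <= x] !=set0)
    (supp_h120 : supp h120 `<=` [set x : R | D1 x /\ x <= a])
    (supp_h121 : supp h121 `<=` [set x : R | D1 x /\ a <= x])
    (h120_h121_a : D1 a -> ev h120 a = 0 \/ ev h121 a = 0)
    (int_h120 : 0 < Int h120)
    (int_h121 : 0 < Int h121)
    (DP4 : forall (d : nat) (DD : {set 'I_d} -> {set {set 'I_d}}),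
      (0 < d)%N -> (forall u, DD u \subset powerset u) ->
      `|\sum_(u : {set 'I_d}) \sum_(v in DD u) block (F d) h11 h120 h121 u v|
      <= `|\sum_(u : {set 'I_d}) \sum_(v in powerset u)
             block (F d) h11 h120 h121 u v|)
    (int_h11 : 0 < Int h11) :
  let alpha := Num.max (Int h120) (Int h121) / (Int h120 + Int h121) in
  let alpha1 := Int h11 in
  let alpha2 := Int h120 + Int h121 in
  let alpha3 := alpha2 / alpha1 in
  [/\ (2^-1 <= alpha < 1) /\ 0 < alpha3,
      forall d N, (0 < d)%N -> (0 < N)%N ->
        ((alpha1 ^+ d / `|tensor_pow (F d) h1| *
          \sum_(k < d.+1) 'C(d, k)%:R * alpha3 ^+ k *
             Num.max (1 - N%:R * alpha ^+ k) 0)%:E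
         <= minimal_error (F d) N)%E,
      forall C : R, 1 < C < alpha `^ (- (alpha3 / (1 + alpha3))) ->
        limn_einf (fun d => minimal_error (F d) (Num.truncn (C ^+ d)) /
                            initial_error (F d))%E = 1%E /\
        (forall eps : R, 0 < eps < 1 ->
           exists d0 : nat, (0 < d0)%N /\ forall d, (d0 <= d)%N ->
             ((Num.truncn (C ^+ d))%:R%:E <= info_complexity (F d) eps)%E) &
      curse_of_dimensionality (fun eps d => info_complexity (F d) eps)].
Proof.
move=> alpha alpha1 alpha2 alpha3.
have alpha2_gt0 : 0 < alpha2 by rewrite addr_gt0.
have alpha3_gt0 : 0 < alpha3 by rewrite divr_gt0.
have alpha_ge : 2^-1 <= alpha.
  rewrite ler_pdivlMr// mulrC ler_pdivrMr// /alpha2.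
  have : Int h120 <= Num.max (Int h120) (Int h121) by rewrite le_max lexx.
  have : Int h121 <= Num.max (Int h120) (Int h121) by rewrite le_max lexx orbT.
  lra.
have alpha_lt1 : alpha < 1.
  by rewrite ltr_pdivrMr// mul1r gt_max ltrDl ltrDr int_h120 int_h121.
have alpha_gt0 : 0 < alpha by apply: lt_le_trans alpha_ge; rewrite invr_gt0.
(* Left of [a] the support condition kills [h121], right of [a] it kills [h120]; the common point
   [a] is settled by [h120_h121_a]. *)
have gh0 x : D1 x -> ev h120 x = 0 \/ ev h121 x = 0.
  case: (ltgtP x a) => [xa D1x|xa D1x|->]; last exact: h120_h121_a.
  - by right; apply: (supp_ev0 supp_h121 D1x) => /= -[_]; rewrite leNgt xa.
  - by left; apply: (supp_ev0 supp_h120 D1x) => /= -[_]; rewrite leNgt xa.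
have Int_h1 : Int h1 = alpha1 * (1 + alpha3).
  rewrite h1E !IntD// /alpha3 mulrDr mulr1 mulrC divfK ?gt_eqF//.
  by rewrite addrA.
have Int_h1_gt0 : 0 < Int h1 by rewrite Int_h1 mulr_gt0// addr_gt0.
have h1_gt0 : 0 < `|h1|.
  rewrite normr_gt0; apply: contraTneq Int_h1_gt0 => ->.
  by rewrite Int0// ltxx.
have norm_hd d : `|tensor_pow (F d) h1| = `|h1| ^+ d.
  by rewrite crossnorm prodr_const card_ord.
pose e1 := Int h1 / `|h1|.
have e1_gt0 : 0 < e1 by rewrite divr_gt0.
have initial_errorE d : (0 < d)%N -> initial_error (F d) = (e1 ^+ d)%:E.
  move=> d0; rewrite worst_hd// IntZ; last exact: measurable_cube.
  by rewrite norm_hd Int_tensor// prodr_const card_ord expr_div_n mulrC.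
have lower d N : (0 < d)%N ->
    ((alpha1 ^+ d / `|tensor_pow (F d) h1| *
      \sum_(k < d.+1) 'C(d, k)%:R * alpha3 ^+ k *
        Num.max (1 - N%:R * alpha ^+ k) 0)%:E <= minimal_error (F d) N)%E.
  move=> d0; have hd_gt0 : 0 < `|tensor_pow (F d) h1|.
    by rewrite norm_hd exprn_gt0.
  rewrite h1E in hd_gt0 *; apply: minimal_error_ge => // DD DDu.
  exact: DP4.
(* Since [Int h1 = alpha1 * (1 + alpha3)], the factor [(1 + alpha3) ^ d] completes the prefactor to
   the initial error [e1 ^ d]. *)
have asymptotic C : 1 < C < alpha `^ (- (alpha3 / (1 + alpha3))) ->
    exists2 r, 0 < r < 1 & forall d N, (0 < d)%N -> (0 < N)%N ->
      N%:R <= C ^+ d ->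
      ((e1 ^+ d * (1 - r ^+ d))%:E <= minimal_error (F d) N)%E.
  move=> /(binomial_sum_asymptotics alpha_gt0 alpha3_gt0)[r r01 rP].
  exists r => // d N d0 N0 NC; apply: le_trans (lower d N d0).
  rewrite lee_fin norm_hd /e1 Int_h1 expr_div_n exprMn.
  have -> : alpha1 ^+ d * (1 + alpha3) ^+ d / `|h1| ^+ d * (1 - r ^+ d) =
      alpha1 ^+ d / `|h1| ^+ d * ((1 + alpha3) ^+ d * (1 - r ^+ d)) by ring.
  apply: ler_wpM2l; last exact: rP.
  by rewrite divr_ge0 ?exprn_ge0// ltW.
have complexity C eps : 1 < C < alpha `^ (- (alpha3 / (1 + alpha3))) ->
    0 < eps < 1 -> exists d0 : nat, (0 < d0)%N /\ forall d, (d0 <= d)%N ->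
      ((Num.truncn (C ^+ d))%:R%:E <= info_complexity (F d) eps)%E.
  move=> CP /andP[_ eps1]; have [r /andP[r0 r1] rP] := asymptotic C CP.
  have C0 : 0 < C by case/andP: CP => C1 _; exact: lt_trans C1.
  have r_cvg : r ^+ n @[n --> \oo] --> (0 : R).
    by apply: cvg_expr; rewrite gtr0_norm.
  (* Once [r ^ d < 1 - eps], every [N <= C ^ d] leaves an error above [eps] times the initial one;
     [d0.+1] keeps the dimension positive. *)
  have /cvgr_lt/(_ (1 - eps)) := r_cvg; rewrite subr_gt0 => /(_ eps1)[d0 _ d0P].
  exists d0.+1; split=> // d dd0; have d_gt0 : (0 < d)%N by apply: leq_trans dd0.
  apply: le_ereal_inf_tmp => _ [N [N0 NP] <-]; rewrite lee_fin ler_nat leqNgt.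
  apply/negP => NC; have {}NC : N%:R <= C ^+ d.
    by rewrite -truncn_ge_nat ?exprn_ge0 ?(ltW C0)// ltnW.
  have := le_trans (rP d N d_gt0 N0 NC) NP.
  rewrite initial_errorE// -EFinM lee_fin mulrC ler_pM2r ?exprn_gt0//.
  by have /= := d0P d (ltnW dd0); lra.
split=> //; first by rewrite alpha_ge.
- by move=> d N d0 _; exact: lower.
- move=> C CP; split; last by move=> eps; exact: complexity.
  have [r /andP[r0 r1] rP] := asymptotic C CP.
  have C1 : 1 < C by case/andP: CP.
  have r_cvg : r ^+ n @[n --> \oo] --> (0 : R).
    by apply: cvg_expr; rewrite gtr0_norm.
  (* The ratio even converges, squeezed between [1 - r ^ d] and 1. *)
  apply: (cvg_limn_einf_sup _).1.
  apply: (@squeeze_cvge _ _ _ _ (fun d => (1 - r ^+ d)%:E) _ (fun=> 1%E)).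
  + near=> d; have d_gt0 : (0 < d)%N by near: d; exact: nbhs_infty_gt.
    have ed0 : 0 < e1 ^+ d by rewrite exprn_gt0.
    rewrite initial_errorE// inver gt_eqF// lee_pdivlMr// lee_pdivrMr//.
    rewrite mul1e -initial_errorE// minimal_error_le_initial ?andbT.
      have Cd1 : 1 <= C ^+ d by rewrite exprn_ege1// ltW.
      rewrite initial_errorE// -EFinM mulrC rP//; first by rewrite truncn_gt0.
      by rewrite truncn_le (le_trans _ Cd1).
    by have [x [D1x _]] := D0_neq0; exists [tuple x | j < d] => j;
      rewrite tnth_mktuple.
  + apply: cvg_EFin; first by near=> d.
    rewrite -[X in _ --> X]subr0.
    by apply: cvgB => //; exact: cvg_cst.
  + exact: cvg_cst.
- set A := alpha `^ (- (alpha3 / (1 + alpha3))) in asymptotic complexity.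
  have A1 : 1 < A.
    rewrite /A /powR gt_eqF// expR_gt1 mulNr oppr_gt0 pmulr_rlt0.
      by rewrite ln_lt0 ?alpha_gt0.
    by rewrite divr_gt0// addr_gt0.
  (* The midpoint of the admissible interval, which is non-empty because [alpha < 1]. *)
  pose C := (1 + A) / 2.
  have C1 : 1 < C by rewrite /C; lra.
  have [d0 [_ d0P]] : exists d0 : nat, (0 < d0)%N /\ forall d, (d0 <= d)%N ->
      ((Num.truncn (C ^+ d))%:R%:E <= info_complexity (F d) 2^-1)%E.
    by apply: complexity; rewrite ?C1 /C; lra.
  (* The constant [c = 1/2] absorbs the rounding: a real [y >= 1] has integer part at least
     [y / 2]. *)
  exists 2^-1, 2^-1, (C - 1), d0; split=> //; first by rewrite subr_gt0.
  move=> d /d0P; apply: le_trans; rewrite lee_fin subrKC.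
  have Cd1 : 1 <= C ^+ d by rewrite exprn_ege1// ltW.
  have := truncnS_gt (C ^+ d); rewrite -natr1.
  have : 1 <= (Num.truncn (C ^+ d))%:R :> R.
    by rewrite ler1n truncn_gt0.
  lra.
Unshelve. all: by end_near.
Qed.
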